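(* Let $M\subseteq\mathbb{Z}^q_{\geq0}$ be an affine monoid. Then (1) $\operatorname{mpdim}(M)\leq\operatorname{rank}(M)$. (2) $\operatorname{mpdim}(M)\geq0$ if and only if $M$ is seminormal. (3) $\operatorname{mpdim}(M)=\operatorname{rank}(M)$ if and only if $M$ is normal.
   Context: An affine monoid $M\subseteq\mathbb{Z}^q_{\geq 0}$ ($q$ a positive integer) is a finitely generated submonoid of $\mathbb{Z}^q$ contained in $\mathbb{Z}^q_{\geq0}$. $\mathbb{Z}M$ is the group generated by $M$, $C(M)=\mathbb{R}_{\geq0}M$ is the cone generated by $M$, and the rank of a monoid $N$ is $\dim_{\mathbb{Q}}(\mathbb{Q}\otimes_{\mathbb{Z}}\mathbb{Z}N)$. $M$ is seminormal if whenever $\alpha\in\mathbb{Z}M$ satisfies $2\alpha\in M$ and $3\alpha\in M$, then $\alpha\in M$; $M$ is normal if $C(M)\cap\mathbb{Z}M=M$. For an integer $m>1$, $\frac1mM=\{\gamma/m:\gamma\in M\}$ and $$V_m(M)=\left\{\alpha\in\tfrac1mM \;\middle|\; \left(\tfrac1mM-\alpha\right)\cap\mathbb{Z}M\subseteq M\right\}.$$ The pure prime of $M$ is $\mathcal{P}(M)=M\setminus\bigcup_{m>1}mV_m(M)$. There is a face $\mathcal{F}_M$ of $C(M)$, possibly empty (the pure prime face), with $M\setminus\mathcal{P}(M)=M\cap\mathcal{F}_M$. The pure dimension is $\operatorname{mpdim}(M)=\operatorname{rank}(M\cap\mathcal{F}_M)$, with $\operatorname{mpdim}(M)=-\infty$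 if $\mathcal{F}_M=\emptyset$ (i.e. if $\mathcal{P}(M)=M$). *)

(* Defs.v *)
From HB Require Import structures.
From mathcomp Require Import all_boot all_order all_algebra.
From mathcomp Require Import all_classical all_reals.

Set Implicit Arguments.
Unset Strict Implicit.
Unset Printing Implicit Defensive.

Import Order.TTheory GRing.Theory Num.Theory.

Local Open Scope classical_set_scope.
Local Open Scope ring_scope.

(* Subsets of Z^q, Q^q and R^q are sets of row vectors; [emb F] is the canonical
   map Z^q -> F^q, used with F = rat for (1/m)M and for ranks, and with F = R
   for cones and their faces. *)
Definition emb (F : pzRingType) (q : nat) (x : 'rV[int]_q) : 'rV[F]_q :=
  map_mx intr x.
Arguments emb F {q} x.

Section AffineMonoids.
Variable q : nat.
Implicit Types (M N : set 'rV[int]_q).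

Definition affine_monoid M : Prop :=
  (exists s : seq 'rV[int]_q,
     M = smallest (fun A => GRing.nmod_closed (mem A)) [set` s])
  /\ M `<=` [set x | forall i, 0 <= x 0 i].

Definition group_gen N : set 'rV[int]_q :=
  smallest (fun A => GRing.zmod_closed (mem A)) N.

(* By flatness of Q, Q (x) ZN is the Q-subspace of Q (x) Z^q = Q^q spanned by ZN.
   The default value 0 is never used: see [Qspan_spec]. *)
Definition Qspan N : {vspace 'rV[rat]_q} :=
  xget 0%VS [set U : {vspace 'rV[rat]_q} |
    [set` U] = smallest (fun A => GRing.submod_closed (mem A))
                        (emb rat @` group_gen N)].

Lemma Qspan_spec N :
  [set` Qspan N] = smallest (fun A => GRing.submod_closed (mem A))
                            (emb rat @` group_gen N).
Proof.
rewrite /Qspan; set A := _ @` _; set S := (X in xget _ X).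
suff US : exists U, S U by exact: (xgetPex 0%VS US).
pose P (d : nat) := `[< exists2 s : seq 'rV[rat]_q, [set` s] `<=` A & \dim <<s>> = d >].
have P0 : exists d, P d.
  by exists 0%N; apply/asboolP; exists [::]; rewrite ?span_nil ?dimv0.
have Pb d : P d -> (d <= \dim {:'rV[rat]_q})%N.
  by move=> /asboolP[s _ <-]; apply/dimvS/subvf.
case: (ex_maxnP P0 Pb) => d /asboolP Pd dmax.
case: Pd dmax => s sA <- dmax.
exists <<s>>%VS; apply/seteqP; split => x /=.
  move=> /(@coord_span _ _ _ (in_tuple s))-> B /= [[B0 Blin] AB].
  have BD u v : B u -> B v -> B (u + v).
    move=> Bu Bv; rewrite -[u]scale1r.
    by apply/set_mem/(Blin 1); apply/mem_set.
  apply: (big_ind B) => [|//|i _]; first exact: set_mem.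
  rewrite -[_ *: _]addr0; apply/set_mem/Blin => //.
  by apply/mem_set/AB/sA; rewrite /= mem_nth.
move=> xA; apply: (xA [set` <<s>>%VS]); split.
  split; first by apply/mem_set; rewrite /= mem0v.
  move=> a u v /set_mem/= us /set_mem/= vs; apply/mem_set => /=.
  by rewrite memvD ?memvZ.
move=> a Aa /=; apply: contraT => as_.
suff /dmax : P (\dim <<a :: s>>).
  move=> le_d; have /eqP E : (<<s>> == <<a :: s>>)%VS.
    by rewrite eqEdim le_d andbT span_cons addvSr.
  by move: as_; rewrite E memv_span ?mem_head.
apply/asboolP; exists (a :: s) => // b /=.
by rewrite inE => /orP[/eqP->//|]; exact: sA.
Qed.

Definition rank N : nat := \dim (Qspan N).

Definition seminormal M : Prop :=
  forall a, group_gen M a -> M (a *+ 2) -> M (a *+ 3) -> M a.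

Definition frac (m : nat) M : set 'rV[rat]_q :=
  [set m%:R^-1 *: emb rat x | x in M].

Definition V_ (m : nat) M : set 'rV[rat]_q :=
  [set a | frac m M a /\
    [set b - a | b in frac m M] `&` (emb rat @` group_gen M)
      `<=` emb rat @` M].

Definition pure_prime M : set 'rV[int]_q :=
  M `\` emb rat @^-1` (\bigcup_(m in [set m | (1 < m)%N])
                         [set m%:R *: a | a in V_ m M]).

Section Cones.
Variable R : realType.
Implicit Types (C F : set 'rV[R]_q).

Definition cone M : set 'rV[R]_q :=
  [set x | exists n (c : 'I_n -> R) (v : 'I_n -> 'rV[int]_q),
    [/\ forall i, 0 <= c i, forall i, M (v i) &
        x = \sum_(i < n) c i *: emb R (v i)]].

Definition normal M : Prop :=
  emb R @^-1` cone M `&` group_gen M = M.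

(* Faces are cut out by valid inequalities; u = 0 gives the improper faces C
   (for b = 0) and set0 (for b < 0). *)
Definition face C F : Prop :=
  exists (u : 'rV[R]_q) (b : R),
    (forall x, C x -> b <= \sum_i u 0 i * x 0 i) /\
    F = [set x | C x /\ \sum_i u 0 i * x 0 i = b].

(* A face of [cone M] is the cone over its intersection with M, so at most one F
   satisfies the description. *)
Definition pure_prime_face M : set 'rV[R]_q :=
  xget set0 [set F | face (cone M) F /\
                     M `\` pure_prime M = M `&` emb R @^-1` F].

Definition mpdim M : \bar int :=
  if pure_prime_face M == set0 then -oo%E
  else (rank (M `&` emb R @^-1` pure_prime_face M))%:Z%:E.

End Cones.
End AffineMonoids.

(* Main.v *)
(* Let S = M \ P(M): it consists of the x in M for which some m > 1 satisfies
   (x + m z in M => z in M) for all z in ZM. If m works for x and n for y, then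
   m n works for x + m y, so S, if nonempty, is closed under sums and factors.
   By Weyl's theorem C(M) is cut out by finitely many integral forms; those that
   vanish at an interior point of S add up to a form which defines the face F_M.
   - F_M is nonempty iff 0 is in S, i.e. iff for some m > 1, m z in M implies
     z in M on ZM. For M seminormal take m prime to the torsion of all Z^q / ZF,
     F a face of M: then z lies in ZF for the face F of m z, so z + N m z is in M
     for some N; as m and 1 + N m are coprime, k z is in M for all large k,
     and seminormality descends from 2k, 3k to k.
   - rank(M cap F_M) = rank(M) iff the form of F_M vanishes on M, iff S = M.
     If M is normal, x is in S with any m exceeding all facet forms at x.
     If S = M and z = a - b in ZM has k z in M, then k b + j z is in M
     for all j >= 0, and k b in S gives z in M. *)

Require Import Defs.
From mathcomp Require Import all_boot all_order all_algebra.
From mathcomp Require Import all_classical all_reals.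
From mathcomp Require Import lra zify.

Import Order.TTheory GRing.Theory Num.Theory.

Local Open Scope classical_set_scope.
Local Open Scope ring_scope.

(** * Finitely generated cones as intersections of half-spaces *)

(* Fourier-Motzkin elimination of the coefficient of the first generator. *)
Lemma weyl (F : realFieldType) (q n : nat) (A : 'M[F]_(n, q)) :
  exists H : seq 'cV[F]_q, forall x : 'rV[F]_q,
    (exists2 y : 'rV[F]_n, forall i, 0 <= y 0 i & x = y *m A) <->
    (forall h, h \in H -> 0 <= (x *m h) 0 0).
Proof.
elim: n A => [|n IHn]; last rewrite -[n.+1]add1n; move=> A.
  (* Without generators the cone is the origin, cut out by the coordinate forms and their
     opposites. *)
  pose e i : 'cV[F]_q := delta_mx i 0.
  exists ([seq e i | i <- enum 'I_q] ++ [seq - e i | i <- enum 'I_q]) => x; split.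
    by case=> y _ -> h _; rewrite [y]thinmx0 !mul0mx mxE.
  move=> xge0; exists 0 => [[]//|].
  apply/rowP => i; rewrite mul0mx mxE.
  have xi : (x *m e i) 0 0 = x 0 i by rewrite -colE mxE.
  have xp : 0 <= (x *m e i) 0 0.
    by apply: xge0; rewrite mem_cat (map_f e) ?mem_enum.
  have xn : 0 <= (x *m - e i) 0 0.
    by apply: xge0; rewrite mem_cat (map_f (fun i => - e i)) ?orbT ?mem_enum.
  by move: xp xn; rewrite mulmxN [(- (x *m e i)) 0 0]mxE xi; lra.
pose a := usubmx A.
have [H Hcone] := IHn (dsubmx A).
pose v (h : 'cV[F]_q) := (a *m h) 0 0.
have dotB (x : 'rV[F]_q) b c h k :
    (x *m (b *: h - c *: k)) 0 0 = b * (x *m h) 0 0 - c * (x *m k) 0 0.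
  by rewrite mulmxBr -!scalemxAr !mxE.
(* Forms nonnegative on [a] are kept; a form [k] negative on [a] is combined with each of these so
   that the result vanishes on [a]. *)
exists ([seq h <- H | 0 <= v h] ++
  [seq v h *: k - v k *: h | h <- [seq h <- H | 0 <= v h],
                             k <- [seq k <- H | v k < 0]]) => x.
split.
  case=> y y0 ->.
  pose t := y 0 (lshift n (ord0 : 'I_1)).
  have yE : y *m A = t *: a + rsubmx y *m dsubmx A.
    rewrite -[in LHS](hsubmxK y) -[A in LHS](vsubmxK A).
    rewrite mul_row_col; congr (_ + _).
    by rewrite [lsubmx _]mx11_scalar mul_scalar_mx mxE.
  set z := _ *m dsubmx _ in yE.
  have z0 h : h \in H -> 0 <= (z *m h) 0 0.
    by apply: (Hcone z).1; exists (rsubmx y) => // i; rewrite mxE.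
  have t0 : 0 <= t by exact: y0.
  have yh h : (y *m A *m h) 0 0 = t * v h + (z *m h) 0 0.
    by rewrite yE mulmxDl -scalemxAl /v !mxE.
  move=> h; rewrite mem_cat => /orP[|].
    by rewrite mem_filter yh => /andP[vh /z0 zh]; rewrite addr_ge0 ?mulr_ge0.
  case/allpairsP => -[h1 k] /= []; rewrite !mem_filter.
  move=> /andP[vh /z0 zh] /andP[vk /z0 zk] ->.
  rewrite dotB !yh; nra.
move=> xge0.
have xh h : h \in H -> 0 <= v h -> 0 <= (x *m h) 0 0.
  by move=> hH vh; apply: xge0; rewrite mem_cat mem_filter vh hH.
have xhk h k : h \in H -> 0 <= v h -> k \in H -> v k < 0 ->
    0 <= v h * (x *m k) 0 0 - v k * (x *m h) 0 0.
  move=> hH vh kH vk.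
  have /xge0 : v h *: k - v k *: h \in [seq h <- H | 0 <= v h] ++
    [seq v h *: k - v k *: h | h <- [seq h <- H | 0 <= v h],
                             k <- [seq k <- H | v k < 0]].
    rewrite mem_cat; apply/orP; right; apply/allpairsP; exists (h, k) => /=.
    by rewrite !mem_filter vh vk hH kH.
  by rewrite dotB.
pose r k := (x *m k) 0 0 / v k.
(* The coefficient of [a]: the least nonnegative [t] for which [x - t *: a] satisfies every form
   negative on [a]. The combined forms say that [t] also respects the upper bounds from forms
   positive on [a]. *)
pose t := \big[Order.max/0]_(k <- H | v k < 0) r k.
have t0 : 0 <= t by exact: bigmax_ge_id.
have [y y0 xE] : exists2 y : 'rV[F]_n, forall i, 0 <= y 0 i &
    x - t *: a = y *m dsubmx A.
  apply/Hcone => h hH.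
  have -> : ((x - t *: a) *m h) 0 0 = (x *m h) 0 0 - t * v h.
    by rewrite mulmxBl -scalemxAl /v !mxE.
  rewrite subr_ge0.
  have [vh|vh|vh] := ltgtP (v h) 0.
  - rewrite -ler_ndivrMr //.
    exact: (@Order.TotalTheory.le_bigmax_seq _ _ _ _ 0 h (fun k => v k < 0) r).
  - rewrite -ler_pdivlMr //.
    rewrite /t big_seq_cond; apply: bigmax_le => [|k /andP[kH vk]].
      by rewrite divr_ge0 ?xh // ltW.
    rewrite /r ler_ndivrMr // mulrAC ler_pdivrMr //.
    have := xhk h k hH (ltW vh) kH vk; nra.
  - by rewrite vh mulr0 xh ?vh.
exists (row_mx t%:M y : 'rV_(1 + n)).
  move=> i; rewrite mxE; case: splitP => j _ //.
  by rewrite !ord1 mxE eqxx mulr1n.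
rewrite -[A](vsubmxK A) mul_row_col mul_scalar_mx.
by rewrite -xE -/a addrC subrK.
Qed.

(** * Integral forms and torsion of quotient lattices *)

Lemma clear_denom (m n : nat) (A : 'M[rat]_(m, n)) :
  exists2 d : nat, (0 < d)%N &
    exists B : 'M[int]_(m, n), d%:R *: A = map_mx intr B.
Proof.
pose D := \prod_(p : 'I_m * 'I_n) `|denq (A p.1 p.2)|%N.
exists D; first by rewrite prodn_gt0 // => p; rewrite absz_gt0 denq_neq0.
have /(_ _ _)/cid-/(_ _ _) H : forall i j, exists b : int, D%:R * A i j = b%:~R.
  move=> i j.
  have -> : D = (\prod_(p | p != (i, j)) `|denq (A p.1 p.2)| * `|denq (A i j)|)%N.
    by rewrite /D (bigD1 (i, j)) // mulnC.
  exists ((\prod_(p | p != (i, j)) `|denq (A p.1 p.2)|)%N%:Z * numq (A i j)).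
  rewrite natrM -mulrA rmorphM /=; congr (_ * _).
  rewrite numqE mulrC; congr (_ * _).
  by rewrite -[in RHS](absz_denq (A i j)).
exists (\matrix_(i, j) sval (H i j)); apply/matrixP => i j; rewrite !mxE.
by case: (H i j).
Qed.

Lemma emb_inj (F : numFieldType) q : injective (@emb F q).
Proof. by move=> x y /rowP E; apply/rowP => i; have := E i; rewrite !mxE => /intr_inj. Qed.

Lemma embD (F : pzRingType) q (x y : 'rV[int]_q) : emb F (x + y) = emb F x + emb F y.
Proof. exact: map_mxD. Qed.

Lemma embMn (F : pzRingType) q (x : 'rV[int]_q) k : emb F (x *+ k) = emb F x *+ k.
Proof. exact: raddfMn. Qed.

(** Weyl's theorem over Q: scaling makes the forms integral, and the factor [k] absorbs the
    denominators of the coefficients. *)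
Lemma weyl_int (q n : nat) (A : 'M[int]_(n, q)) :
  exists H : seq 'cV[int]_q, forall x : 'rV[int]_q,
    (exists2 k, (0 < k)%N &
       exists2 y : 'rV[int]_n, forall i, 0 <= y 0 i & x *+ k = y *m A) <->
    (forall h, h \in H -> 0 <= (x *m h) 0 0).
Proof.
have [H Hcone] := weyl _ _ _ (map_mx intr A : 'M[rat]_(n, q)).
have /(_ _)/cid2-/(_ _) D (h : 'cV[rat]_q) := clear_denom _ _ h.
have /(_ _)/cid-/(_ _) B h := s2valP' (D h).
exists [seq sval (B h) | h <- H] => x.
have xh h : (x *m sval (B h)) 0 0 >= 0 <-> (emb rat x *m h) 0 0 >= 0.
  case: (B h) => b /= bE.
  have E : ((x *m b) 0 0)%:~R = (s2val (D h))%:R * (emb rat x *m h) 0 0.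
    have -> : ((x *m b) 0 0)%:~R = (map_mx intr (x *m b) : 'M[rat]_1) 0 0 by rewrite [RHS]mxE.
    by rewrite map_mxM -bE -scalemxAr [LHS]mxE.
  by rewrite -(ler0z rat) E pmulr_rge0 // ltr0n (s2valP (D h)).
split.
  case=> k k0 [y y0 yE] _ /mapP[h hH ->]; apply/xh.
  apply: (Hcone (emb rat x)).1 h hH; exists (k%:R^-1 *: emb rat y).
    by move=> i; rewrite !mxE mulr_ge0 ?invr_ge0 ?ler0n ?ler0z.
  rewrite -scalemxAl -map_mxM -yE -/(emb rat _) embMn -scaler_nat scalerA.
  by rewrite mulVf ?scale1r // pnatr_eq0 -lt0n.
move=> xge0.
have [|y y0 xE] := (Hcone (emb rat x)).2.
  by move=> h hH; apply/xh/xge0/map_f.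
have [d d0 [z zE]] := clear_denom _ _ y.
exists d => //; exists z.
  move=> i; rewrite -(ler0z rat).
  have -> : (z 0 i)%:~R = (map_mx intr z : 'rV[rat]_n) 0 i by rewrite mxE.
  by rewrite -zE mxE mulr_ge0 ?ler0n.
apply: (emb_inj rat); rewrite embMn -scaler_nat xE scalemxAl zE.
by rewrite /emb map_mxM.
Qed.

(** In Smith normal form the torsion of Z^n modulo the row lattice of [A] is killed by the product
    of the nonzero invariant factors. *)
Lemma torsion_exponent (m n : nat) (A : 'M[int]_(m, n)) :
  exists2 t : nat, (0 < t)%N & forall z k (y : 'rV[int]_m), (0 < k)%N ->
    z *+ k = y *m A -> exists y' : 'rV[int]_m, z *+ t = y' *m A.
Proof.
have [L L1 [R R1 [d _ ->]]] := int_Smith_normal_form A.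
set D := \matrix_(i, j) _.
pose t := (\prod_(x <- d | x != 0%R) `|x|)%N.
have t0 : (0 < t)%N by rewrite prodn_cond_gt0 // => x; rewrite absz_gt0.
have dt i : d`_i != 0 -> ((t%:Z %/ d`_i)%Z * d`_i = t%:Z).
  move=> di; apply/divzK; rewrite dvdzE /=.
  rewrite /t (big_rem d`_i) ?di ?dvdn_mulr //=.
  by rewrite mem_nth // ltnNge; apply: contra di => ?; rewrite nth_default.
exists t => // z k y k0 zE.
have [w wz] : exists w, z = w *m R by exists (z *m invmx R); rewrite mulmxKV.
have wD j : w 0 j *+ k = \sum_i (y *m L) 0 i * (d`_i *+ (i == j :> nat)).
  have : w *+ k = y *m L *m D.
    apply: (can_inj (mulmxK R1)); rewrite -mulmxA.
    by rewrite -[w *+ k]scaler_nat -scalemxAl -wz scaler_nat zE !mulmxA.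
  move=> /rowP/(_ j); rewrite mulmxnE => ->; rewrite mxE.
  by apply: eq_bigr => i _; rewrite [D _ _]mxE.
(* The sum selects the [i]-th entry of [w], or gives 0 when [i] is not a column index, since [m] and
   [n] may differ. *)
pose v := \row_(i < m) \sum_j (w 0 j *+ (i == j :> nat) * (t%:Z %/ d`_i)%Z).
have vD : w *+ t = v *m D.
  apply/rowP => j; rewrite mulmxnE [RHS]mxE.
  have [jm|jm] := ltnP j m; last first.
    have wj0 : w 0 j = 0.
      have := wD j; rewrite big1; last first.
        by move=> i _; rewrite ltn_eqF ?mulr0 // (leq_trans (ltn_ord i)).
      by move=> /eqP; rewrite mulrn_eq0 -[k == _]negbK -lt0n k0 => /eqP.
    rewrite wj0 mul0rn big1 // => i _; rewrite [D _ _]mxE ltn_eqF ?mulr0 //.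
    exact: leq_trans jm.
  have E (f : 'I_m -> int) : \sum_i f i * (d`_i *+ (i == j :> nat)) =
      f (Ordinal jm) * d`_j.
    rewrite (bigD1 (Ordinal jm)) //= eqxx mulr1n big1 ?addr0 // => i.
    by rewrite -val_eqE /= => /negPf->; rewrite mulr0.
  transitivity (\sum_i v 0 i * (d`_i *+ (i == j :> nat))); last first.
    by apply: eq_bigr => i _; rewrite [D _ _]mxE.
  have := wD j; rewrite !E.
  rewrite [v _ _]mxE (bigD1 j) //= eqxx mulr1n big1 ?addr0; last first.
    by move=> i; rewrite -val_eqE eq_sym /= => /negPf->; rewrite mul0r.
  have [->|dj] := eqVneq d`_j 0; last by rewrite -mulrA dt // => _; rewrite -mulr_natr natz.
  rewrite !mulr0 => /eqP; rewrite mulrn_eq0 -[k == _]negbK -lt0n k0 => /eqP->.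
  by rewrite mul0rn.
exists (v *m invmx L).
rewrite !mulmxA mulmxKV // -vD wz -scaler_nat scalemxAl.
by rewrite scaler_nat.
Qed.

(** * Affine monoids and the groups they generate *)

Lemma affine_monoidP (q : nat) (M : set 'rV[int]_q) : affine_monoid M ->
  exists n (A : 'M[int]_(n, q)), forall x,
    M x <-> exists2 y : 'rV[int]_n, forall i, 0 <= y 0 i & x = y *m A.
Proof.
case=> -[s ->] _; pose A := \matrix_(i < size s) tnth (in_tuple s) i.
exists (size s), A => x; split.
  apply: (smallest_sub (X := [set x | exists2 y : 'rV[int]_(size s),
     forall i, 0 <= y 0 i & x = y *m A])) => /=.
    split; first by apply/mem_set; exists 0; rewrite ?mul0mx // => i; rewrite mxE.
    move=> u v /set_mem[y y0 ->] /set_mem[z z0 ->]; apply/mem_set.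
    by exists (y + z); rewrite ?mulmxDl // => i; rewrite mxE addr_ge0.
  move=> u /= /(tnthP (in_tuple s))[i ->]; exists (delta_mx 0 i).
    by move=> j; rewrite mxE.
  by rewrite -rowE rowK.
case=> y y0 -> B /= [[B0 BD] sB].
rewrite mulmx_sum_row; apply/set_mem; apply: (big_ind (fun u => u \in B)) => // i _.
rewrite rowK; have := y0 i; case: (y 0 i) => // k _.
have Bi : tnth (in_tuple s) i \in B by apply/mem_set/sB; rewrite /= mem_tnth.
have -> : Posz k = k%:R by rewrite natz.
rewrite scaler_nat.
by elim: k => [|k IHk]; rewrite ?mulr0n // mulrS; apply: BD.
Qed.

Lemma affine_monoid0 (q : nat) (M : set 'rV[int]_q) : affine_monoid M -> M 0.
Proof. by case=> -[s ->] _ B /= [[B0 _] _]; apply: set_mem. Qed.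

Lemma affine_monoidD (q : nat) (M : set 'rV[int]_q) : affine_monoid M ->
  forall x y, M x -> M y -> M (x + y).
Proof.
case=> -[s ->] _ x y xM yM B B_; have [[_ BD] _] := B_.
by apply/set_mem/BD; apply/mem_set; [apply: xM|apply: yM].
Qed.

Lemma affine_monoidMn (q : nat) (M : set 'rV[int]_q) : affine_monoid M ->
  forall x k, M x -> M (x *+ k).
Proof.
move=> MM x k xM; elim: k => [|k IHk]; first exact: affine_monoid0.
by rewrite mulrS; apply: affine_monoidD.
Qed.

Lemma group_gen_sub (q : nat) (N : set 'rV[int]_q) : N `<=` group_gen N.
Proof. exact: sub_gen_smallest. Qed.

Lemma group_genB (q : nat) (N : set 'rV[int]_q) x y :
  group_gen N x -> group_gen N y -> group_gen N (x - y).
Proof.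
move=> xN yN B B_; have [[_ BB] _] := B_.
by apply/set_mem/BB; apply/mem_set; [apply: xN|apply: yN].
Qed.

Lemma group_genMn (q : nat) (N : set 'rV[int]_q) x k :
  group_gen N x -> group_gen N (x *+ k).
Proof.
move=> xN; have N0 : group_gen N 0 by rewrite -(subrr x); apply: group_genB.
elim: k => [//|k IHk]; rewrite mulrSr -[x in _ + x]opprK -[- x]sub0r.
by apply: group_genB => //; apply: group_genB.
Qed.

Lemma group_genP (q : nat) (M : set 'rV[int]_q) z : affine_monoid M ->
  group_gen M z -> exists a b, [/\ M a, M b & z = a - b].
Proof.
move=> MM; have M0 := affine_monoid0 _ _ MM; have MD := affine_monoidD _ _ MM.
apply: (smallest_sub (X := [set z | exists a b, [/\ M a, M b & z = a - b]])) => /=.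
  split; first by apply/mem_set; exists 0, 0; rewrite subr0.
  move=> u v /set_mem[a [b [aM bM ->]]] /set_mem[c [d [cM dM ->]]]; apply/mem_set.
  exists (a + d), (b + c); split; [exact: MD|exact: MD|].
  by rewrite opprB addrACA opprD.
by move=> x xM; exists x, 0; rewrite subr0.
Qed.

(** * The complement of the pure prime *)

(** Writing elements of (1/m)M as (x + m z)/m turns the condition that x/m lies in V_m(M) into one
    on integral vectors z. *)
Lemma not_pure_primeP (q : nat) (M : set 'rV[int]_q) x :
  (M `\` pure_prime M) x <->
  M x /\ exists2 m, (1 < m)%N & forall z, group_gen M z -> M (x + z *+ m) -> M z.
Proof.
have mK m (u : 'rV[rat]_q) : (1 < m)%N -> m%:R *: (m%:R^-1 *: u) = u.
  move=> m1; rewrite scalerA mulfV ?scale1r // pnatr_eq0 -lt0n; exact: ltnW.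
split.
  case=> xM; rewrite /pure_prime /setD /= => /not_andP[//|/contrapT[m /= m1]].
  case=> _ [[y yM <-]] H; rewrite mK // => /emb_inj yx; rewrite yx in yM H.
  split=> //; exists m => // z zM xzM.
  have /H[w wM /emb_inj <- //] : ([set b - m%:R^-1 *: emb rat x | b in Defs.frac m M] `&`
    (emb rat @` group_gen M)) (emb rat z).
  split; last by exists z.
  exists (m%:R^-1 *: emb rat (x + z *+ m)); first by exists (x + z *+ m).
  rewrite embD embMn scalerDr addrC addKr -scaler_nat scalerA mulVf ?scale1r //.
  by rewrite pnatr_eq0 -lt0n; exact: ltnW.
case=> xM [m m1 H]; split=> // -[_]; apply; exists m => //=.
exists (m%:R^-1 *: emb rat x); last exact: mK.
split; first by exists x.
move=> _ [[_ [y yM <-] <-] [z zM zE]]; exists z; last by rewrite zE.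
apply: H => //; suff -> : x + z *+ m = y by [].
apply: (emb_inj rat); rewrite embD embMn zE -scaler_nat scalerBr !mK //.
by rewrite addrC subrK.
Qed.

Lemma not_pure_prime_factor (q : nat) (M : set 'rV[int]_q) x y :
  affine_monoid M -> M x -> M y ->
  (M `\` pure_prime M) (x + y) -> (M `\` pure_prime M) x.
Proof.
move=> MM xM yM /not_pure_primeP[_ [m m1 H]]; apply/not_pure_primeP; split=> //.
exists m => // z zM xzM; apply: H => //.
by rewrite addrAC; apply: affine_monoidD.
Qed.

Lemma not_pure_primeD (q : nat) (M : set 'rV[int]_q) x y : affine_monoid M ->
  (M `\` pure_prime M) x -> (M `\` pure_prime M) y -> (M `\` pure_prime M) (x + y).
Proof.
move=> MM /not_pure_primeP[xM [m m1 Hm]] /not_pure_primeP[yM [n n1 Hn]].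
have MD := affine_monoidD _ _ MM; have MMn := affine_monoidMn _ _ MM.
(* It suffices to treat x + m y. As x + m y + m n z = x + m (y + n z), the modulus [m] of [x]
   applies first, then the modulus [n] of [y]. *)
apply: (not_pure_prime_factor _ _ _ (y *+ m.-1)) => //; [exact: MD|exact: MMn|].
have -> : x + y + y *+ m.-1 = x + y *+ m.
  by rewrite -addrA -mulrS prednK //; exact: ltnW.
apply/not_pure_primeP; split; first exact/MD/MMn.
exists (m * n)%N; first by rewrite -[1%N]muln1 ltn_mul.
have [xG yG] : group_gen M x /\ group_gen M y by split; apply: group_gen_sub.
move=> z zG; rewrite -addrA mulnC mulrnA -mulrnDl => xyzM; apply: Hn => //.
apply: Hm => //; rewrite addrC -[y]opprK; apply: group_genB; first exact: group_genMn.
by rewrite -[- y]sub0r; apply: group_genB => //; apply: group_gen_sub; apply: affine_monoid0.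
Qed.

Lemma not_pure_primeMn (q : nat) (M : set 'rV[int]_q) x k : affine_monoid M ->
  (M `\` pure_prime M) x -> (M `\` pure_prime M) (x *+ k).
Proof.
move=> MM xS; elim: k => [|k IHk]; last by rewrite mulrS; apply: not_pure_primeD.
apply: (not_pure_prime_factor _ _ _ x) => //; first exact: affine_monoid0.
  by case: xS.
by rewrite mulr0n add0r.
Qed.

(** * Multiples lying in the monoid: half-spaces and seminormal descent *)

Lemma affine_monoid_halfspaces (q : nat) (M : set 'rV[int]_q) : affine_monoid M ->
  exists H : seq 'cV[int]_q, forall x,
    (exists2 k, (0 < k)%N & M (x *+ k)) <-> (forall h, h \in H -> 0 <= (x *m h) 0 0).
Proof.
case/affine_monoidP=> n [A AM]; have [H HA] := weyl_int _ _ A.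
by exists H => x; rewrite -HA; split=> -[k k0 /AM]; exists k => //; apply/AM.
Qed.

(** Descent on [K]: for K >= 2 both 2(K - 1) and 3(K - 1) are at least K, so seminormality puts (K -
    1) z in [M]. *)
Lemma seminormal_root (q : nat) (M : set 'rV[int]_q) z K : seminormal M ->
  group_gen M z -> (forall k, (K <= k)%N -> M (z *+ k)) -> M z.
Proof.
move=> sM zG; elim: K => [|[|K] IHK] H; try by rewrite -[z]mulr1n; apply: H.
apply: IHK => k; rewrite leq_eqVlt => /predU1P[<-|/H//].
by apply: sM; [exact: group_genMn| |]; rewrite -mulrnA; apply: H; lia.
Qed.

(** Sets [T] of generators stand in for the faces of [M], so that [m] is chosen from finitely many
    torsion exponents before [z] is given. *)
Lemma seminormal_pure_modulus (q : nat) (M : set 'rV[int]_q) :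
  affine_monoid M -> seminormal M ->
  exists2 m, (1 < m)%N & forall z, group_gen M z -> M (z *+ m) -> M z.
Proof.
move=> MM sM; have [n [A AM]] := affine_monoidP _ _ MM.
have MD := affine_monoidD _ _ MM; have MMn := affine_monoidMn _ _ MM.
(* Zeroing the rows outside [T] leaves a matrix whose rows span the group generated by [T]. *)
pose mask (T : {set 'I_n}) := \matrix_(i < n, j < q) (A i j *+ (i \in T)).
have /(_ _)/cid2-/(_ _) tor T := torsion_exponent _ _ (mask T).
pose t T := s2val (tor T); have t0 T : (0 < t T)%N := s2valP (tor T).
(* [1 + \prod_T t T] is prime to the torsion of Z^q / ZT for every set T of generators. *)
pose m := (1 + \prod_T t T)%N.
have m1 : (1 < m)%N by rewrite /m ltnS prodn_gt0.
exists m => // z zG zmM; have /AM[y y0 yE] := zmM.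
pose T : {set 'I_n} := finset (fun i => y 0 i != 0).
have maskE (w : 'rV_n) : w *m mask T = (\row_i (w 0 i *+ (i \in T))) *m A.
  apply/rowP => j; rewrite !mxE; apply: eq_bigr => i _; rewrite !mxE.
  by rewrite mulrnAr mulrnAl.
have yT : y *m A = y *m mask T.
  rewrite maskE; congr (_ *m _); apply/rowP => i; rewrite mxE inE.
  by case: eqVneq => [->|_]; rewrite ?mulr1n.
have [v vE] := s2valP' (tor T) z m y (ltnW m1) (etrans yE yT).
have [c cE] : exists c, (\prod_T t T = t T * c)%N.
  by exists (\prod_(U | U != T) t U)%N; rewrite (bigD1 T).
have [w zE] : exists w : 'rV_n, z = w *m mask T.
  (* Here [y] represents m z and [v *+ c] represents (m - 1) z. *)
  exists (y - v *+ c); rewrite mulmxBl -yT -yE -[v *+ c]scaler_nat -scalemxAl scaler_nat -vE.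
  by rewrite -mulrnA -cE /m mulrnDr mulr1n addrK.
(* [N] bounds the coefficients of z on [T], where m z has coefficients at least 1; hence z + N m z
   has nonnegative coefficients. *)
pose N := (\sum_(i < n) `|w 0%R i|)%N.
have zN : M (z *+ (1 + m * N)).
  apply/AM; exists (\row_i (w 0 i *+ (i \in T)) + y *+ N).
    move=> i; rewrite !mxE inE mulmxnE.
    have wN : (`|w 0%R i| <= N)%N by rewrite /N (bigD1 i) //= leq_addr.
    have := y0 i; case: eqVneq => [->|yi]; first by rewrite mul0rn addr0.
    rewrite mulr1n -mulr_natr natz => yi0.
    have : N%:Z <= y 0 i * N%:Z by rewrite ler_peMl //; lia.
    by move: wN; move: (w 0 i) (y 0 i * N%:Z) => a b; clearbody N; lia.
  rewrite mulmxDl -maskE -zE -[y *+ N]scaler_nat -scalemxAl scaler_nat -yE.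
  by rewrite mulrnDr mulr1n mulrnA.
(* As 1 + m N is 1 modulo m, subtracting (1 + m N)(k mod m) from k leaves a multiple of m,
   nonnegative once k >= m m N. *)
apply: (seminormal_root _ _ _ (m * m * N)%N) => // k Kk.
have m0 := ltnW m1.
pose r := (k %% m)%N; have rm : (r < m)%N by rewrite ltn_mod.
have kE : k = ((1 + m * N) * r + m * (k %/ m - r * N))%N.
  have qk : (m * N <= k %/ m)%N by rewrite leq_divRL // mulnAC.
  have := divn_eq k m; rewrite -/r; nia.
by rewrite kE mulrnDr !mulrnA; apply: MD; apply: (MMn).
Qed.

(** * Real cones and their faces *)

Lemma cone_sub (R : realType) (q : nat) (M : set 'rV[int]_q) x k :
  (0 < k)%N -> M (x *+ k) -> cone M (emb R x).
Proof.
move=> k0 xM; exists 1%N, (fun=> k%:R^-1), (fun=> x *+ k); split=> //.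
  by move=> _; rewrite invr_ge0 ler0n.
rewrite big_ord1 embMn -scaler_nat scalerA mulVf ?scale1r //.
by rewrite pnatr_eq0 -lt0n.
Qed.

Lemma coneZ (R : realType) (q : nat) (M : set 'rV[int]_q) t (x : 'rV[R]_q) :
  0 <= t -> cone M x -> cone M (t *: x).
Proof.
move=> t0 [n [c [v [c0 vM ->]]]]; exists n, (fun i => t * c i), v; split=> //.
  by move=> i; rewrite mulr_ge0.
by rewrite scaler_sumr; apply: eq_bigr => i _; rewrite scalerA.
Qed.

Lemma cone_ge0 (R : realType) (q : nat) (M : set 'rV[int]_q) (u x : 'rV[R]_q) :
  (forall y, M y -> 0 <= \sum_i u 0 i * emb R y 0 i) -> cone M x ->
  0 <= \sum_i u 0 i * x 0 i.
Proof.
move=> uM [n [c [v [c0 vM ->]]]].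
have -> : \sum_i u 0 i * (\sum_(j < n) c j *: emb R (v j)) 0 i =
    \sum_(j < n) c j * \sum_i u 0 i * emb R (v j) 0 i.
  under eq_bigr do rewrite summxE mulr_sumr.
  rewrite exchange_big; apply: eq_bigr => j _; rewrite mulr_sumr.
  by apply: eq_bigr => i _; rewrite mxE mulrCA.
by apply: sumr_ge0 => j _; rewrite mulr_ge0 ?uM.
Qed.

Lemma sum_emb (R : realType) (q : nat) (h : 'cV[int]_q) (x : 'rV[int]_q) :
  \sum_i (emb R h^T) 0 i * emb R x 0 i = ((x *m h) 0 0)%:~R.
Proof.
rewrite mxE rmorph_sum; apply: eq_bigr => i _.
by rewrite !mxE rmorphM mulrC.
Qed.

(** Integral forms nonnegative on [M] stay nonnegative on the real cone, which brings the question
    from R back to Z. *)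
Lemma cone_int (R : realType) (q : nat) (M : set 'rV[int]_q) x :
  affine_monoid M -> cone M (emb R x) -> exists2 k, (0 < k)%N & M (x *+ k).
Proof.
move=> MM xC; have [H HM] := affine_monoid_halfspaces _ _ MM.
apply/HM => h hH; rewrite -(ler0z R) -sum_emb; apply: cone_ge0 xC => y yM.
by rewrite sum_emb ler0z; apply: (HM y).1 => //; exists 1%N.
Qed.

(** A supporting hyperplane that meets a cone passes through the origin: scaling a common point by 0
    and by 2 gives b <= 0 and b <= 2b. *)
Lemma face_cone (R : realType) (q : nat) (M : set 'rV[int]_q) (F : set 'rV[R]_q) :
  face (@cone q R M) F -> F !=set0 ->
  exists2 u : 'rV[R]_q, forall x, cone M x -> 0 <= \sum_i u 0 i * x 0 i &
    F = [set x | cone M x /\ \sum_i u 0 i * x 0 i = 0].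
Proof.
case=> u [b [ub ->]] [x [xC xb]].
have E t : \sum_i u 0 i * (t *: x) 0 i = t * b.
  rewrite -xb mulr_sumr; apply: eq_bigr => i _.
  by rewrite mxE mulrCA.
have /ub := coneZ _ _ _ _ _ (ler0n _ 0) xC; rewrite E mul0r => b_le0.
have /ub := coneZ _ _ _ _ _ (ler0n _ 2) xC; rewrite E => b_ge0.
have b0 : b = 0 by lra.
by exists u => [y /ub|]; rewrite b0.
Qed.

(** * Existence of the pure prime face *)

(* The point s lies in the relative interior of the pure prime face. *)
Lemma not_pure_prime_interior (q : nat) (M : set 'rV[int]_q) (H : seq 'cV[int]_q) :
  affine_monoid M -> (forall x h, M x -> h \in H -> 0 <= (x *m h) 0 0) ->
  (M `\` pure_prime M) !=set0 ->
  exists2 s, (M `\` pure_prime M) s & forall h, h \in H -> (s *m h) 0 0 = 0 ->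
    forall x, (M `\` pure_prime M) x -> (x *m h) 0 0 = 0.
Proof.
move=> MM HM [s0 s0S]; elim: H HM => [_|h H IH HM]; first by exists s0.
have [|s sS sH] := IH; first by move=> x k xM kH; apply: HM; rewrite // inE kH orbT.
have hM x : (M `\` pure_prime M) x -> 0 <= (x *m h) 0 0.
  by case=> xM _; apply: HM; rewrite ?mem_head.
have HM' x k : (M `\` pure_prime M) x -> k \in H -> 0 <= (x *m k) 0 0.
  by case=> xM _ kH; apply: HM; rewrite // inE kH orbT.
have mD (x y : 'rV_q) (k : 'cV[int]_q) :
  ((x + y) *m k) 0 0 = (x *m k) 0 0 + (y *m k) 0 0 by rewrite mulmxDl mxE.
have [h0|/existsNP[y /not_implyP[yS /eqP yh]]] :=
  pselect (forall x, (M `\` pure_prime M) x -> (x *m h) 0 0 = 0).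
  by exists s => // k; rewrite inE => /predU1P[-> _|/sH].
(* The form [h] is positive at [y], and by nonnegativity any form of [H] that vanishes at s + y
   already vanishes at [s]. *)
exists (s + y); first exact: not_pure_primeD.
move=> k; rewrite inE mD => /predU1P[->|kH] /eqP.
  by rewrite paddr_eq0 ?hM // (negPf yh) andbF.
by rewrite paddr_eq0 ?HM' // => /andP[/eqP ? _]; apply: sH.
Qed.

(** The face is cut out by the sum [h0] of the forms vanishing at an interior point [s]. Conversely,
    an [x] in [M] killed by [h0] is a factor of a multiple of [s]. *)
Lemma pure_prime_face_exists (R : realType) (q : nat) (M : set 'rV[int]_q) :
  affine_monoid M -> exists F : set 'rV[R]_q,
    face (@cone q R M) F /\ M `\` pure_prime M = M `&` emb R @^-1` F.
Proof.
move=> MM; have [H HM] := affine_monoid_halfspaces _ _ MM.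
have HM1 x h : M x -> h \in H -> 0 <= (x *m h) 0 0.
  by move=> xM; apply: (HM x).1; exists 1%N.
have [S0|/set0P S0] := eqVneq (M `\` pure_prime M) set0.
  exists set0; rewrite S0 preimage_set0 setI0; split=> //.
  have u0 (x : 'rV[R]_q) : \sum_i (0 : 'rV[R]_q) 0 i * x 0 i = 0.
    by rewrite big1 // => i _; rewrite mxE mul0r.
  (* The zero form with bound -1 is valid and never attains its bound, so it defines the empty
     face. *)
  exists 0, (-1); split=> [x _|]; first by rewrite u0 lerN10.
  by apply/seteqP; split=> // x [_]; rewrite u0; lra.
have [s sS sH] := not_pure_prime_interior _ _ _ MM HM1 S0.
pose h0 := \sum_(h <- H | (s *m h) 0 0 == 0) h.
have h0E (x : 'rV_q) : (x *m h0) 0 0 = \sum_(h <- H | (s *m h) 0 0 == 0) (x *m h) 0 0.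
  by rewrite /h0 mulmx_sumr summxE.
have h0M x : M x -> 0 <= (x *m h0) 0 0.
  by move=> xM; rewrite h0E big_seq_cond sumr_ge0 // => h /andP[hH _]; apply: HM1.
exists [set x | cone M x /\ \sum_i (emb R h0^T) 0 i * x 0 i = 0]; split.
  exists (emb R h0^T), 0; split=> // x; apply: cone_ge0 => y yM.
  by rewrite sum_emb ler0z h0M.
apply/seteqP; split=> x.
  move=> xS; have [xM _] := xS; split=> //; split; first exact: (@cone_sub _ _ _ _ 1%N).
  rewrite sum_emb h0E big_seq_cond big1 // => h /andP[hH /eqP sh0].
  exact: (sH h).
case=> xM [_ /eqP]; rewrite sum_emb intr_eq0 h0E big_seq_cond.
rewrite psumr_eq0 => [/allP xh0|h /andP[hH _]]; last exact: HM1.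
(* Every form is nonnegative on N s - x: if h(s) = 0 then h(x) = 0, and otherwise h(s) >= 1 while
   |h(x)| <= N. *)
pose N := (\sum_(h <- H) `|((x *m h) 0 0)%R|)%N.
have [|k k0 yM] := (HM (s *+ N - x)).2.
  move=> h hH; rewrite mulmxBl -scaler_nat -scalemxAl.
  have -> : (N%:R *: (s *m h) - x *m h) 0 0 = N%:R * (s *m h) 0 0 - (x *m h) 0 0.
    by rewrite !mxE.
  have [sM _] := sS; have s0 := HM1 _ _ sM hH; rewrite natz.
  have xN : (`|((x *m h) 0 0)%R| <= N)%N by rewrite /N (big_rem h) //= leq_addr.
  have [sh0|shN] := eqVneq ((s *m h) 0 0) 0.
    by have := xh0 h hH; rewrite hH sh0 eqxx /= => /eqP->; rewrite mulr0 subrr.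
  have : N%:Z <= N%:Z * (s *m h) 0 0 by rewrite ler_peMr //; lia.
  move: xN; move: ((x *m h) 0 0) (N%:Z * _) => a b; clearbody N; lia.
have MMn := affine_monoidMn _ _ MM; have MD := affine_monoidD _ _ MM.
(* The multiple is k N s = k x + k (N s - x). *)
apply: (not_pure_prime_factor _ _ _ (x *+ k.-1 + (s *+ N - x) *+ k)) => //.
  by apply: MD => //; apply: MMn.
rewrite addrA -mulrS prednK // mulrnBl addrC subrK.
by do 2!apply: not_pure_primeMn => //.
Qed.

Lemma pure_prime_faceP (R : realType) (q : nat) (M : set 'rV[int]_q) :
  affine_monoid M -> face (@cone q R M) (@pure_prime_face q R M) /\
    M `\` pure_prime M = M `&` emb R @^-1` @pure_prime_face q R M.
Proof. by move=> MM; exact: (xgetPex set0 (pure_prime_face_exists R _ _ MM)). Qed.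

(** A nonempty face of a cone contains the origin. *)
Lemma pure_prime_face_neq0 (R : realType) (q : nat) (M : set 'rV[int]_q) :
  affine_monoid M ->
  @pure_prime_face q R M !=set0 <-> (M `\` pure_prime M) 0.
Proof.
move=> MM; have [Fface SE] := pure_prime_faceP R _ _ MM.
rewrite SE; split=> [F0|[_ ?]]; last by exists (emb R 0).
have M0 := affine_monoid0 _ _ MM; split=> //=.
have [u _ ->] := face_cone _ _ _ _ Fface F0; split.
  exact: (@cone_sub _ _ _ _ 1%N).
by rewrite big1 // => i _; rewrite !mxE mulr0.
Qed.

(** * The extreme cases: seminormal and normal monoids *)

Lemma zero_not_pure_prime_seminormal (q : nat) (M : set 'rV[int]_q) : affine_monoid M ->
  (M `\` pure_prime M) 0 <-> seminormal M.
Proof.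
move=> MM; have M0 := affine_monoid0 _ _ MM; split.
  move=> /not_pure_primeP[_ [m m1 H]] a aG a2 a3; apply: H => //; rewrite add0r.
  have MMn := affine_monoidMn _ _ MM; have MD := affine_monoidD _ _ MM.
  (* Every m > 1 is a sum of twos and at most one three. *)
  have -> : m = (2 * (m./2 - odd m) + 3 * odd m)%N.
    have := odd_double_half m; case: (odd m); lia.
  by rewrite mulrnDr !mulrnA; apply: MD; apply: MMn.
move=> sM; have [m m1 H] := seminormal_pure_modulus _ _ MM sM.
by apply/not_pure_primeP; split=> //; exists m => // z zG; rewrite add0r; apply: H.
Qed.

Lemma no_pure_prime_normal (R : realType) (q : nat) (M : set 'rV[int]_q) : affine_monoid M ->
  M `\` pure_prime M = M <-> normal R M.
Proof.
move=> MM; have MMn := affine_monoidMn _ _ MM; have MD := affine_monoidD _ _ MM.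
split=> [SM|nM].
  apply/seteqP; split=> z; last first.
    move=> zM; split; last exact: group_gen_sub.
    exact: (@cone_sub _ _ _ _ 1%N).
  case=> /= /cone_int-/(_ MM)[k k0 zkM] zG.
  have [a [b [aM bM zE]]] := group_genP _ _ _ MM zG.
  have : M (b *+ k) by exact: MMn.
  rewrite -{1}SM => /not_pure_primeP[_ [m _]]; apply=> //.
  have rk : (m %% k < k)%N by rewrite ltn_mod.
  (* With r = m mod k, k b + r z = r a + (k - r) b, and the rest of m z is a multiple of k z. *)
  have -> : b *+ k + z *+ m =
      z *+ k *+ (m %/ k) + (a *+ (m %% k) + b *+ (k - m %% k)).
    rewrite {1}(divn_eq m k) mulrnDr mulnC mulrnA addrCA; congr (_ + _).
    by rewrite {1}zE mulrnBl addrCA -mulrnBr // ltnW.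
  by apply: (MD); [exact: MMn|apply: (MD); exact: MMn].
apply/seteqP; split=> x; first by case.
move=> xM; apply/not_pure_primeP; split=> //.
have [H HM] := affine_monoid_halfspaces _ _ MM.
pose N := (\sum_(h <- H) `|((x *m h) 0 0)%R|)%N.
(* If h(z) <= -1, then h(x + (N + 2) z) <= N - (N + 2) < 0. Taking N + 2 keeps the modulus above 1
   even if N = 0. *)
exists N.+2 => // z zG xzM; rewrite -nM; split=> //=.
have [|k k0 zkM] := (HM z).2; last exact: cone_sub zkM.
move=> h hH; have : 0 <= ((x + z *+ N.+2) *m h) 0 0.
  by apply: (HM (x + z *+ N.+2)).1 => //; exists 1%N.
rewrite mulmxDl -scaler_nat -scalemxAl natz.
have -> : (x *m h + N.+2%:Z *: (z *m h)) 0 0 = (x *m h) 0 0 + N.+2%:Z * (z *m h) 0 0.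
  by rewrite !mxE.
have xN : (`|((x *m h) 0 0)%R| <= N)%N by rewrite /N (big_rem h) //= leq_addr.
move: xN; move: ((x *m h) 0 0) ((z *m h) 0 0) => a b; clearbody N.
case: (leP 0 b) => // b0 aN ab.
have : N.+2%:Z * b <= N.+2%:Z * -1 by apply: ler_wpM2l; lia.
lia.
Qed.

(** * Comparison of ranks and conclusion *)

Lemma group_genS (q : nat) (N M : set 'rV[int]_q) :
  N `<=` M -> group_gen N `<=` group_gen M.
Proof.
move=> NM x xN B [B_ MB]; apply: xN; split=> //.
exact: subset_trans MB.
Qed.

Lemma QspanS (q : nat) (N M : set 'rV[int]_q) : N `<=` M -> (Qspan N <= Qspan M)%VS.
Proof.
move=> NM; apply/subvP => x.
suff : [set` Qspan N] `<=` [set` Qspan M] by apply.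
rewrite !Qspan_spec => y yN B [B_ MB]; apply: yN; split=> //.
by apply: subset_trans MB; apply: image_subset; apply: group_genS.
Qed.

(** The real form [u] gives a Q-linear map [f] from Q^q to R, whose kernel contains the span of [N];
    by equality of dimensions this is the span of [M]. *)
Lemma rank_eq_vanish (R : realType) (q : nat) (N M : set 'rV[int]_q) (u : 'rV[R]_q) :
  N `<=` M -> rank N = rank M ->
  (forall x, N x -> \sum_i u 0 i * emb R x 0 i = 0) ->
  forall x, M x -> \sum_i u 0 i * emb R x 0 i = 0.
Proof.
move=> NM rNM uN x xM.
pose f (v : 'rV[rat]_q) : R := \sum_i u 0 i * ratr (v 0 i).
have fE y : f (emb rat y) = \sum_i u 0 i * emb R y 0 i.
  by apply: eq_bigr => i _; rewrite !mxE ratr_int.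
have fD a v w : f (a *: v + w) = ratr a * f v + f w.
  rewrite /f mulr_sumr -big_split; apply: eq_bigr => i _.
  by rewrite !mxE rmorphD rmorphM /= mulrDr mulrCA.
have f0 : f 0 = 0 by apply: big1 => i _; rewrite mxE rmorph0 mulr0.
have fNG y : group_gen N y -> f (emb rat y) = 0.
  apply: (smallest_sub (X := [set y | f (emb rat y) = 0])) => [|z zN /=].
    split; first by apply/mem_set; rewrite /= /emb map_mx0.
    move=> v w /set_mem/= v0 /set_mem/= w0; apply/mem_set => /=.
    have -> : emb rat (v - w) = (-1) *: emb rat w + emb rat v.
      by rewrite /emb map_mxB scaleN1r addrC.
    by rewrite fD v0 w0 mulr0 addr0.
  by rewrite fE uN.
have /eqP QE : (Qspan N == Qspan M)%VS by rewrite eqEdim QspanS //= -/(rank M) -rNM.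
rewrite -fE.
have : [set` Qspan N] (emb rat x).
  by rewrite QE Qspan_spec => B [_]; apply; exists x => //; apply: group_gen_sub.
rewrite Qspan_spec; apply: (smallest_sub (X := [set v | f v = 0])).
  split; first exact/mem_set.
  move=> a v w /set_mem/= v0 /set_mem/= w0; apply/mem_set => /=.
  by rewrite fD v0 w0 mulr0 addr0.
by move=> _ [y yG <-]; apply: fNG.
Qed.

Theorem corollary3p30 (R : realType) (q : nat) (hq : (0 < q)%N)
    (M : set 'rV[int]_q) (hM : affine_monoid M) :
  [/\ (mpdim R M <= (rank M)%:Z%:E)%E,
      (0%:E <= mpdim R M)%E <-> seminormal M &
      mpdim R M = (rank M)%:Z%:E <-> normal R M].
Proof.
have [Fface SE] := pure_prime_faceP R _ _ hM.
(* Seminormality becomes nonemptiness of the face, and normality becomes the equality of [M] with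
   the complement of its pure prime. *)
rewrite -(propext (zero_not_pure_prime_seminormal _ _ hM)).
rewrite -(propext (no_pure_prime_normal R _ _ hM)).
rewrite -(propext (pure_prime_face_neq0 R _ _ hM)) /mpdim.
have [F0|/set0P F0] := eqVneq (@pure_prime_face q R M) set0.
  split; first exact: leNye.
    by split=> //; rewrite F0 => -[].
  (* The complement of the pure prime is empty here, so it cannot be [M], which contains 0. *)
  split=> // SM; have := affine_monoid0 _ _ hM.
  by rewrite -SM SE F0 => -[].
have subM : M `&` emb R @^-1` @pure_prime_face q R M `<=` M by move=> x [].
split; first by rewrite lee_fin lez_nat; apply/dimvS/QspanS.
  by split=> // _; rewrite lee_fin.
rewrite SE; split=> [[rE]|->//].
apply/seteqP; split=> // x xM; split=> //=.
have [u _ FE] := face_cone _ _ _ _ Fface F0.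
rewrite FE; split; first exact: (@cone_sub _ _ _ _ 1%N).
apply: rank_eq_vanish subM rE _ _ xM => y [_].
by rewrite /= FE => -[].
Qed.
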